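(* Let $1\le p<\infty$ and $1\le q<\infty$. If $\dfrac{2q}{p}-2q+4\ne0$, then the chirp transform operator $T$ is not of weak-type $(p,q)$.
   Context: The chirp transform of $f\in L^1(\mathbb R)$ is $Tf(\lambda)=\int_{\mathbb R}f(x)e^{-\pi i\lambda x^2}\,dx$, $\lambda\in\mathbb R$. With $m$ the Lebesgue measure on $\mathbb R$, $T$ is of weak-type $(p,q)$ if there is a constant $C>0$ such that for every $\eta>0$ and every $f\in L^1(\mathbb R)\cap L^p(\mathbb R)$, $$m(\{\lambda\in\mathbb R:|Tf(\lambda)|>\eta\})\le\left(\frac{C\|f\|_p}{\eta}\right)^q.$$ *)

(* Defs.v *)
From HB Require Import structures.
From mathcomp Require Import all_boot all_order all_algebra.
From mathcomp Require Import complex.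
From mathcomp Require Import all_classical all_reals all_analysis.

Set Implicit Arguments.
Unset Strict Implicit.
Unset Printing Implicit Defensive.

Import Order.TTheory GRing.Theory Num.Theory.
Import numFieldNormedType.Exports.

Local Open Scope classical_set_scope.
Local Open Scope ring_scope.
Local Open Scope complex_scope.

(* [R[i]] carries no sigma-algebra and no Lebesgue integral in the library, so
   measurability and integration of complex-valued functions go through real
   and imaginary parts. [Normc.normc] is the complex modulus with values in R. *)

Section ComplexFunctions.
Context d (T : measurableType d) (R : realType).
Variable mu : {measure set T -> \bar R}.

(* Each part is a [Rintegral], hence has junk value 0 when its Lebesgue
   integral is infinite; this does not occur for f in L^1. *)
Definition Cintegral (f : T -> R[i]) : R[i] :=
  (\int[mu]_x complex.Re (f x)) +i* (\int[mu]_x complex.Im (f x)).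

Definition Cmeasurable (f : T -> R[i]) : Prop :=
  measurable_fun setT (fun x => complex.Re (f x)) /\
  measurable_fun setT (fun x => complex.Im (f x)).

Definition CLnorm (p : R) (f : T -> R[i]) : \bar R :=
  Lnorm mu p%:E (fun x => (Normc.normc (f x))%:E).

Definition CLfun (p : R) (f : T -> R[i]) : Prop :=
  Cmeasurable f /\ (CLnorm p f < +oo)%E.

End ComplexFunctions.

(* e^{i t} for real t *)
Definition expi (R : realType) (t : R) : R[i] := cos t +i* sin t.

Definition chirp (R : realType) (f : R -> R[i]) (lambda : R) : R[i] :=
  Cintegral (@lebesgue_measure R)
    (fun x : R => f x * expi (- (pi * lambda * x ^+ 2))).

Definition weak_type (R : realType) (S : (R -> R[i]) -> (R -> R[i]))
    (p q : R) : Prop :=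
  exists2 C : R, 0 < C &
    forall (eta : R) (f : R -> R[i]), 0 < eta ->
      CLfun (@lebesgue_measure R) 1 f -> CLfun (@lebesgue_measure R) p f ->
      (lebesgue_measure
         [set lambda : R | (eta < Normc.normc (S f lambda))%R]
       <= (C%:E * CLnorm (@lebesgue_measure R) p f * (eta^-1)%:E) `^ q)%E.

(* Main.v *)
(* Test [T] on indicators of the intervals [[0, r]]. Their L^p norm is
   [r `^ p^-1], and |T f| >= r / sqrt 2 on [[0, (4 * r ^+ 2)^-1]] since the chirp
   barely oscillates there. A weak-type (p, q) bound thus forces
   [1 <= K * r `^ (q / p - q + 2)] for a fixed [K] and every [r > 0], which fails
   as [r] tends to 0 or to infinity unless the exponent vanishes. *)
Require Import Defs.
From HB Require Import structures.
From mathcomp Require Import all_boot all_order all_algebra.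
From mathcomp Require Import ring lra.
From mathcomp Require Import complex.
From mathcomp Require Import all_classical all_reals all_analysis.
From mathcomp Require Import measurable_realfun.

Import Order.TTheory GRing.Theory Num.Theory.
Import numFieldNormedType.Exports.
Local Open Scope ring_scope.

Definition boxC (R : realType) (r x : R) : R[i] :=
  Complex (\1_(`[0, r]%classic : set R) x) 0.

Lemma normc_boxC (R : realType) (r x : R) :
  Normc.normc (boxC R r x) = \1_(`[0, r]%classic : set R) x.
Proof. by rewrite /boxC /= expr0n/= addr0 sqrtr_sqr ger0_norm. Qed.

Lemma Re_le_normc (R : realType) (z : R[i]) : complex.Re z <= Normc.normc z.
Proof.
case: z => a b /=; rewrite (le_trans (ler_norm a))// -sqrtr_sqr.
by rewrite ler_wsqrtr// lerDl sqr_ge0.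
Qed.

Lemma CLnorm_boxC (R : realType) (p r : R) : 0 < p -> 0 < r ->
  CLnorm (@lebesgue_measure R) p (boxC R r) = (r `^ p^-1)%:E.
Proof.
move=> p0 r0; rewrite /CLnorm unlock.
under eq_integral => x _.
  have -> : (`|(Normc.normc (boxC R r x))%:E| `^ p =
      (\1_(`[0, r]%classic : set R) x)%:E)%E.
    rewrite normc_boxC /= ger0_norm// indicE.
    by case: (_ \in _); rewrite /= ?powR1// powR0// gt_eqF.
  over.
rewrite integral_indic//= setIT lebesgue_measure_itv/= lte_fin r0.
by rewrite oppr0 addr0 poweR_EFin.
Qed.

Lemma CLfun_boxC (R : realType) (p r : R) : 0 < p -> 0 < r ->
  CLfun (@lebesgue_measure R) p (boxC R r).
Proof.
move=> p0 r0; split; last by rewrite CLnorm_boxC// ltry.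
by split=> /=; [exact: measurable_indic|exact: measurable_cst].
Qed.

(* For [4 * l * r ^+ 2 <= 1] the phase [pi * l * x ^+ 2] stays in
   [[0, pi / 4]] for every [x] in [[0, r]], so there is no cancellation. *)
Lemma chirp_boxC_ge (R : realType) (r l : R) : 0 < r -> 0 <= l ->
  4 * l * r ^+ 2 <= 1 ->
  cos (pi / 4) * r <= Normc.normc (chirp (boxC R r) l).
Proof.
(* The real part already suffices: its integrand on [[0, r]] is the cosine of the phase, which never
   drops below [cos (pi / 4)]. *)
move=> r0 l0 lr; apply: le_trans (Re_le_normc _ _).
rewrite /chirp /Cintegral /=.
have -> : (\int[lebesgue_measure]_x
    complex.Re (boxC R r x * expi (- (pi * l * x ^+ 2))))%R =
    (\int[lebesgue_measure]_(x in `[0, r]) cos (pi * l * x ^+ 2))%R.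
  rewrite [RHS]Rintegral_mkcond; apply: eq_Rintegral => x _.
  rewrite /boxC /expi /= mul0r subr0 cosN patchE indicE.
  by case: (_ \in _); rewrite ?mul1r ?mul0r.
have -> : cos (pi / 4) * r =
    (\int[@lebesgue_measure R]_(x in `[0, r]) cos (pi / 4))%R.
  by rewrite Rintegral_cst//= lebesgue_measure_itv/= lte_fin r0/= subr0.
apply: le_Rintegral => //.
- apply: continuous_compact_integrable; first exact: segment_compact.
  by apply: continuous_subspaceT => x; exact: cst_continuous.
- apply: continuous_compact_integrable; first exact: segment_compact.
  apply: continuous_subspaceT => x.
  apply: continuous_comp; last exact: continuous_cos.
  by apply: cvgM; [exact: cvg_cst|exact: exprn_continuous].
- move=> x /=; rewrite in_itv/= => /andP[x0 xr].
  have pi0 := pi_gt0 R.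
  have lx0 : 0 <= l * x ^+ 2 by rewrite mulr_ge0// sqr_ge0.
  have lx1 : l * x ^+ 2 <= 1 / 4.
    have : l * x ^+ 2 <= l * r ^+ 2.
      by rewrite ler_wpM2l// lerXn2r// nnegrE// ltW.
    lra.
  (* Cosine is strictly decreasing on [[0, pi]], so the claim reduces to
     [pi * (l * x ^+ 2) <= pi / 4]. *)
  rewrite -mulrA leNgt ltr_cos ?in_itv/= -?leNgt; nra.
Qed.

Lemma weak_type_chirp_le (R : realType) (p q : R) : 0 < p ->
  weak_type (@chirp R) p q ->
  exists2 K : R, 0 < K &
    forall r : R, 0 < r -> 1 <= K * r `^ (q / p - q + 2).
Proof.
move=> p0 [C C0 H].
have c0 : 0 < cos (pi / 4 : R).
  by apply: cos_gt0_pihalf; have := pi_gt0 R; lra.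
set c := cos _ in c0.
(* The 4 comes from the interval length [(4 * r ^+ 2)^-1], and [C * 2 / c] from dividing [C] times
   the norm by the level [c * r / 2]. *)
exists (4 * (C * 2 / c) `^ q).
  by rewrite mulr_gt0// powR_gt0// divr_gt0// mulr_gt0.
move=> r r0.
(* The level is half the lower bound [c * r], because the level set is defined by a strict
   inequality. *)
have cr0 : 0 < c * r / 2 by rewrite divr_gt0// mulr_gt0.
have r20 : 0 < 4 * r ^+ 2 by rewrite mulr_gt0// exprn_gt0.
have b0 : 0 < (4 * r ^+ 2)^-1 by rewrite invr_gt0.
have := H (c * r / 2) (boxC R r) cr0 (CLfun_boxC _ _ _ ltr01 r0)
  (CLfun_boxC _ _ _ p0 r0).
rewrite CLnorm_boxC// -!EFinM poweR_EFin => {}H.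
have : (((4 * r ^+ 2)^-1)%R%:E <=
    ((C * r `^ p^-1 * (c * r / 2)^-1) `^ q)%R%:E)%E.
  apply: le_trans H.
  have -> : ((4 * r ^+ 2)^-1)%:E =
      lebesgue_measure (`[0, (4 * r ^+ 2)^-1]%classic : set R).
    by rewrite lebesgue_measure_itv/= lte_fin b0 -EFinB subr0.
  (* The level set need not be known measurable: the library's Lebesgue measure
     is an outer measure, hence monotone on all sets. *)
  apply: le_mu_ext => l /=; rewrite in_itv/= => /andP[l0 lb].
  apply: (@lt_le_trans _ _ (c * r)); first by lra.
  apply: chirp_boxC_ge => //.
  by rewrite mulrAC mulrC -ler_pdivlMr// div1r.
rewrite lee_fin.
have -> : C * r `^ p^-1 * (c * r / 2)^-1 = (C * 2 / c) * r `^ (p^-1 - 1).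
  rewrite powRD ?powRN ?powRr1 ?ltW//; last by rewrite (gt_eqF r0) implybT.
  by field; rewrite !gt_eqF.
rewrite powRM ?powR_ge0//; last by rewrite ltW// divr_gt0// mulr_gt0.
rewrite -powRrM => h.
have -> : q / p - q + 2 = (p^-1 - 1) * q + 2 by ring.
rewrite powRD; last by rewrite (gt_eqF r0) implybT.
rewrite (powR_mulrn 2 (ltW r0)).
rewrite -[leRHS](_ : (C * 2 / c) `^ q * r `^ ((p^-1 - 1) * q) *
  (4 * r ^+ 2) = _).
  by rewrite -ler_pdivrMr// div1r.
by ring.
Qed.

Theorem proposition4 (R : realType) (p q : R) (hp : 1 <= p) (hq : 1 <= q)
  (hpq : 2 * q / p - 2 * q + 4 != 0) :
  ~ weak_type (@chirp R) p q.
Proof.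
move=> /(weak_type_chirp_le _ _ _ (lt_le_trans ltr01 hp))[K K0 H].
(* This exponent is half the quantity in [hpq]. *)
have s0 : q / p - q + 2 != 0.
  by apply: contra_neq hpq => h; rewrite -[RHS](mulr0 2) -h; ring.
have K20 : 0 < (2 * K)^-1 by rewrite invr_gt0 mulr_gt0.
have := H _ (powR_gt0 (q / p - q + 2)^-1 K20).
rewrite -powRrM mulVf// powRr1 ?(ltW K20)//.
have -> : K * (2 * K)^-1 = 1 / 2 by field; rewrite gt_eqF.
lra.
Qed.
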